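(* Let $G$ be a locally compact abelian topological group, let $(A,\mu)$ be a partially crossed topological $G$-module, and suppose $A$ is a trivial $G$-module. (1) If $A$ is compact without small subgroups, then $H^{1}(G,(A,\mu))$ is a locally compact abelian group. (2) If $G$ is compactly generated and $A$ is locally compact without small subgroups, then $H^{1}(G,(A,\mu))$ is a locally compact abelian group. (3) If $G$ is finite discrete and $A$ is compact without small subgroups, then $H^{1}(G,(A,\mu))$ is a finite discrete abelian group.
   Context: All topological groups are assumed Hausdorff (not necessarily abelian). A topological $G$-module is a topological group $A$ with a continuous left action of the topological group $G$ on $A$ by group automorphisms, $(g,a)\mapsto {}^{g}a$; it is trivial if ${}^{g}a=a$ for all $g,a$. Every topological group acts on itself by conjugation: ${}^{g}h=ghg^{-1}$. A partially crossed topological $G$-module is a pair $(A,\mu)$ where $A$ is a topological $G$-module and $\mu:A\to G$ is a continuous homomorphism with $\mu({}^{g}a)=g\mu(a)g^{-1}$ for all $g\in G$, $a\in A$, and such that ${}^{\mu(a)}b=aba^{-1}$ for all $b\in A$ and all $a\in A$ with $\mu(a)\in[G,G]$ (the commutator subgroup). A crossed homomorphism is a map $\alpha:G\to A$ with $\alpha(gh)=\alpha(g)\,{}^{g}\alpha(h)$ for all $g,h\in G$. $Der_{c}(G,(A,\mu))$ is the set of pairs $(\alpha,r)$ with $\alpha:G\to A$ a continuous crossed homomorphism and $r\in G$ such that $\mu(\alpha(g))=r\,({}^{g}r)^{-1}=r(grg^{-1})^{-1}$ for all $g\in G$ (that is, $(A,\mu)$ is viewed as a $G-G$-bimodule, $G$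 acting on itself by conjugation). It carries the subspace topology from $\mathcal{C}_{k}(G,A)\times G$, where $\mathcal{C}_{k}(G,A)$ is the set of continuous maps $G\to A$ with the compact-open topology, and the product $(\alpha,r)\star(\beta,s)=(\alpha*\beta,rs)$, where $(\alpha*\beta)(g)={}^{r}\beta(g)\,\alpha(g)$. $H^{0}(G,G)=\{r\in G: grg^{-1}=r\ \forall g\in G\}$. On $Der_{c}(G,(A,\mu))$ define $(\alpha,r)\sim(\beta,s)$ iff there is $a\in A$ with $\beta(g)=a^{-1}\alpha(g)\,{}^{g}a$ for all $g\in G$ and $s=\mu(a)^{-1}r$ mod $H^{0}(G,G)$ (i.e. $s\in\mu(a)^{-1}rH^{0}(G,G)$). This is an equivalence relation, and $H^{1}(G,(A,\mu))$ is the quotient set $Der_{c}(G,(A,\mu))/\sim$ with the quotient topology; its group structure is the one induced by $\star$, i.e. $[(\alpha,r)][(\beta,s)]=[(\alpha,r)\star(\beta,s)]$. A topological group is without small subgroups if some neighborhood of the identity contains no nontrivial subgroup. It is compactly generated if it is generated by a compact subset. *)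

(* Defs.v *)
From HB Require Import structures.
From mathcomp Require Import all_boot.
From mathcomp Require Import all_classical topology.

Set Implicit Arguments.
Unset Strict Implicit.
Unset Printing Implicit Defensive.

Local Open Scope classical_set_scope.
Local Open Scope quotient_scope.
Local Open Scope group_scope.

(* Topological groups are Hausdorff and not necessarily commutative; the
   topological groups of MathComp-Analysis are additive and commutative. *)
HB.mixin Record isHausdorffTopologicalGroup G & Topological G & Group G := {
  mulg_continuous : continuous (fun x : G * G => x.1 * x.2);
  invg_continuous : continuous (fun x : G => x^-1);
  topgroup_hausdorff : hausdorff_space G
}.

#[short(type="topGroupType")]
HB.structure Definition TopologicalGroup :=
  { G of isHausdorffTopologicalGroup G & Topological G & Group G }.

(* The same notion for an explicit binary operation on a topological space. *)
Definition topological_group_law (T : topologicalType) (mul : T -> T -> T) :=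
  exists (one : T) (inv : T -> T),
    [/\ associative mul, left_id one mul & left_inverse one inv mul] /\
    [/\ continuous (fun x : T * T => mul x.1 x.2), continuous inv
      & hausdorff_space T].

Definition discrete_space (T : topologicalType) : Prop :=
  @nbhs T T = principal_filter.

Definition subgroup (G : groupType) (H : set G) : Prop := group_closed (mem H).

Definition generated (G : groupType) (S : set G) : set G :=
  smallest (@subgroup G) S.

Definition commutator_subgroup (G : groupType) : set G :=
  generated [set c : G | exists x y : G, c = [~ x, y]].

Definition no_small_subgroups (G : topGroupType) : Prop :=
  exists2 U : set G, nbhs (1 : G) U &
    forall H : set G, subgroup H -> H `<=` U -> H = [set 1].

Definition compactly_generated (G : topGroupType) : Prop :=
  exists2 K : set G, compact K & generated K = [set: G].

Record topModule (G A : topGroupType) := TopModule {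
  gact :> G -> A -> A;
  gact_continuous : continuous (fun x : G * A => gact x.1 x.2);
  gact1 : forall a, gact 1 a = a;
  gactM : forall g h a, gact (g * h) a = gact g (gact h a);
  gact_morph : forall g a b, gact g (a * b) = gact g a * gact g b
}.

Definition trivial_module (G A : topGroupType) (M : topModule G A) : Prop :=
  forall g a, M g a = a.

Record pcModule (G A : topGroupType) := PCModule {
  pc_module :> topModule G A;
  pc_mu : A -> G;
  pc_mu_continuous : continuous pc_mu;
  pc_muM : forall a b, pc_mu (a * b) = pc_mu a * pc_mu b;
  pc_mu_act : forall g a, pc_mu (pc_module g a) = g * pc_mu a * g^-1;
  pc_peiffer : forall a b, commutator_subgroup (pc_mu a) ->
    pc_module (pc_mu a) b = a * b * a^-1
}.

Definition crossed_hom (G A : topGroupType) (M : topModule G A)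
    (alpha : G -> A) : Prop :=
  forall g h, alpha (g * h) = alpha g * M g (alpha h).

(* H^0(G, G) for the conjugation action of G on itself. *)
Definition H0_conj (G : groupType) : set G :=
  [set r | forall g, g * r * g^-1 = r].

Definition Der_set (G A : topGroupType) (M : pcModule G A) :
    set ({compact-open, G -> A} * G) :=
  [set x | [/\ continuous (x.1 : G -> A), crossed_hom M x.1
    & forall g, pc_mu M (x.1 g) = x.2 * (g * x.2 * g^-1)^-1]].

(* The topology of [set_type] is induced from the compact-open topology on all
   functions G -> A times G; since the elements are pairs of a continuous
   function and a point, it is also the one induced from C_k(G, A) x G. *)
Definition Der (G A : topGroupType) (M : pcModule G A) : topologicalType :=
  set_type (Der_set M).

Section Der_theory.
Context (G A : topGroupType) (M : pcModule G A).
Implicit Types x y z : Der M.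

Definition der_map x : G -> A := (set_val x).1.
Definition der_elt x : G := (set_val x).2.

Lemma der_mapP x : [/\ continuous (der_map x), crossed_hom M (der_map x)
  & forall g, pc_mu M (der_map x g)
     = der_elt x * (g * der_elt x * g^-1)^-1].
Proof. by have := set_valP x. Qed.

Lemma gact_1r g : M g 1 = 1.
Proof. by apply: (@mulgI A (M g 1)); rewrite -gact_morph !mulg1. Qed.

Lemma gactV g a : M g a^-1 = (M g a)^-1.
Proof. by apply: (@mulgI A (M g a)); rewrite -gact_morph !mulgV gact_1r. Qed.

Lemma pc_mu1 : pc_mu M 1 = 1.
Proof. by apply: (@mulgI G (pc_mu M 1)); rewrite -pc_muM !mulg1. Qed.

Lemma pc_muV a : pc_mu M a^-1 = (pc_mu M a)^-1.
Proof. by apply: (@mulgI G (pc_mu M a)); rewrite -pc_muM !mulgV pc_mu1. Qed.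

Definition star_val x y : {compact-open, G -> A} * G :=
  ((fun g => M (der_elt x) (der_map y g) * der_map x g),
   der_elt x * der_elt y).

Lemma star_subproof x y : star_val x y \in Der_set M.
Proof.
apply/mem_set.
case: (der_mapP x) => cx hx mx; case: (der_mapP y) => cy hy my.
split=> /=.
- move=> g; apply: (@continuous2_cvg _ _ _ _ _ _ _ _ (fun a b => a * b)).
  + exact: (@mulg_continuous A (_, _)).
  + apply: (@continuous2_cvg _ _ _ _ _ _ _ _ (fun a b => M a b)).
    * exact (@gact_continuous _ _ M (der_elt x, der_map y g)).
    * exact: cvg_cst.
    * exact: cy.
  + exact: cx.
- move=> g h; rewrite /= hx hy !gact_morph -!gactM.
  set r := der_elt x.
  have mg : pc_mu M (der_map x g) = [~ r^-1, g^-1].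
    by rewrite mx /commg /conjg !invgM !invgK !mulgA.
  have := @pc_peiffer _ _ M (der_map x g) (M (g * r) (der_map y h)).
  rewrite mg -gactM => /(_ _)/wrap[].
    by move=> H [_]; apply; exists r^-1, g^-1.
  have -> : [~ r^-1, g^-1] * (g * r) = r * g.
    by rewrite /commg /conjg !invgK -!mulgA mulKg mulVg mulg1.
  by move=> ->; rewrite !mulgA mulgVK.
- move=> g; rewrite pc_muM pc_mu_act mx my !invgM !invgK.
  by rewrite !mulgA !mulgVK.
Qed.

(* (alpha, r) * (beta, s) = (g |-> ^r beta(g) alpha(g), r s) *)
Definition star x y : Der M := exist _ (star_val x y) (star_subproof x y).

Definition der_equiv x y : Prop :=
  exists a : A,
    (forall g, der_map y g = a^-1 * der_map x g * M g a) /\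
    exists2 z, H0_conj z & der_elt y = (pc_mu M a)^-1 * der_elt x * z.

Lemma H0_conjP (z : G) : H0_conj z <-> forall g, g * z = z * g.
Proof.
split=> Hz g; first by rewrite -{2}(Hz g) mulgVK.
by rewrite Hz mulgK.
Qed.

Lemma der_equiv_is_equiv : equiv_class_of (fun x y => `[< der_equiv x y >]).
Proof.
split=> [x|x y|y x z].
- apply/asboolP; exists 1; split=> [g|].
    by rewrite gact_1r invg1 mul1g mulg1.
  exists 1; first by move=> g; rewrite mulg1 mulgV.
  by rewrite pc_mu1 invg1 mul1g mulg1.
- suff H u v : der_equiv u v -> der_equiv v u.
    by apply/asboolP/asboolP; apply: H.
  case=> a [Ha [z /H0_conjP Hz Hr]]; exists a^-1; split=> [g|].
    by rewrite Ha gactV invgK !mulgA mulgV mul1g mulgK.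
  exists z^-1; last by rewrite Hr pc_muV invgK !mulgA mulgV mul1g mulgK.
  by apply/H0_conjP => g; apply: (@mulgI G z); rewrite mulgA -Hz mulgK mulVKg.
- move=> /asboolP[a [Ha [u /H0_conjP Hu Hr]]].
  move=> /asboolP[b [Hb [v /H0_conjP Hv Hs]]].
  apply/asboolP; exists (a * b); split=> [g|].
    by rewrite Hb Ha gact_morph invgM !mulgA.
  exists (u * v); last by rewrite Hs Hr pc_muM invgM !mulgA.
  by apply/H0_conjP => g; rewrite mulgA Hu -mulgA Hv mulgA.
Qed.

Definition der_equivb : equiv_rel (Der M) := EquivRelPack der_equiv_is_equiv.

Definition H1 : topologicalType := quotient_topology {eq_quot der_equivb}.

Definition H1_class : Der M -> H1 := \pi_(quotient_topology {eq_quot der_equivb}).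

Lemma H1_classP x y : H1_class x = H1_class y <-> der_equiv x y.
Proof.
by split=> [/eqmodP/asboolP //|xy]; apply/eqmodP/asboolP.
Qed.

Lemma H1_class_surj (c : H1) : exists x, H1_class x = c.
Proof. by exists (repr c); exact: reprK. Qed.

(* Since [H1_class] is onto, the operation is unique when it exists. *)
Definition H1_topological_abelian_group : Prop :=
  exists mul : H1 -> H1 -> H1,
    [/\ forall x y, mul (H1_class x) (H1_class y) = H1_class (star x y),
        topological_group_law mul & commutative mul].

End Der_theory.

(* Main.v *)
Require Import Defs.
From HB Require Import structures.
From mathcomp Require Import all_boot.
From mathcomp Require Import all_classical topology.

(** Write K for the kernel of mu.  Since G is abelian, the Peiffer condition
applies to every a in K and says that a acts trivially by conjugation, so K is
central in A.  As A is a trivial module, a crossed homomorphism is a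
homomorphism, and the condition relating alpha and r becomes
mu (alpha g) = 1: elements of Der are pairs of a continuous homomorphism
G -> K and an arbitrary r in G.  The relation on Der forgets r and, K being
central, leaves the homomorphism alone.  Hence H^1 is the group Hom_c(G, K)
with the compact-open topology, that is, with the topology of uniform
convergence on compact sets ([H1_cvgP]); this gives the topological group
structure.

Local compactness is an equicontinuity argument.  Let V be a compact
neighborhood of 1 in A containing no nontrivial subgroup.  If all powers of x
lie in V then x = 1; by compactness, for each neighborhood N of 1 finitely
many powers in V already force x in N ([nss_escape]).  So the homomorphisms
mapping a fixed neighborhood C of 1 in G into V are equicontinuous at 1
([nss_equicontinuous]).  If moreover their values at each point stay in a
compact set, an ultrafilter of such homomorphisms converges pointwise, and by
equicontinuity uniformly on compact sets, so they form a compact set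
([H1_bounded_compact]), which is a neighborhood of the trivial homomorphism
when C is compact.  The pointwise bound is automatic when A is compact; when
G is generated by a compact set it suffices to put that set into C, because
the points at which the values are bounded form a subgroup
([generated_bounded]).

If G is finite and discrete one may take C = {1}, so H^1 is compact; and a
homomorphism uniformly close to another on the compact group G differs from
it by a homomorphism whose image is a small subgroup, so H^1 is discrete
([H1_discrete]), hence finite. *)

Set Implicit Arguments.
Unset Strict Implicit.
Unset Printing Implicit Defensive.

Local Open Scope classical_set_scope.
Local Open Scope quotient_scope.
Local Open Scope group_scope.

(** * Topological groups *)

Section topological_group.
Context {G : topGroupType}.
Implicit Types (N U : set G) (x y : G).

Lemma nbhs_mulP x y U : nbhs (x * y) U ->
  exists N N', [/\ nbhs x N, nbhs y N' & forall a b, N a -> N' b -> U (a * b)].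
Proof.
move=> /(@mulg_continuous G (x, y)) [[N N'] /= [Nx N'y] NU].
by exists N, N'; split => // a b Na N'b; apply: (NU (a, b)).
Qed.

Lemma nbhs_invP x U : nbhs x^-1 U -> nbhs x [set y | U y^-1].
Proof. by move=> /(@invg_continuous G x). Qed.

Lemma divg_continuous : continuous (fun p : G * G => p.1 * p.2^-1).
Proof.
move=> p; apply: (@continuous2_cvg _ _ _ _ _ _ _ _ (fun a b : G => a * b)).
- exact: (@mulg_continuous G (_, _)).
- exact: cvg_fst.
- by apply: continuous_cvg; [exact: invg_continuous|exact: cvg_snd].
Qed.

Lemma nbhs_mulgl x U : nbhs x U -> nbhs 1 [set y | U (x * y)].
Proof.
rewrite -{1}(mulg1 x) => /nbhs_mulP[N [N' [/nbhs_singleton Nx N'1 NU]]].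
by apply: filterS N'1 => y; apply: NU.
Qed.

Lemma nbhs_divgl x U : nbhs 1 U -> nbhs x [set y | U (x^-1 * y)].
Proof.
rewrite -{1}(mulVg x) => /nbhs_mulP[N [N' [/nbhs_singleton Nx N'1 NU]]].
by apply: filterS N'1 => y; apply: NU.
Qed.

Lemma nbhs1_divP U : nbhs 1 U ->
  exists2 N, nbhs 1 N & forall a b, N a -> N b -> U (a^-1 * b).
Proof.
rewrite -{1}(mul1g 1) -{1}(@invg1 G).
move=> /nbhs_mulP[N [N' [/nbhs_invP N1 N'1 NU]]].
exists ([set y | N y^-1] `&` N'); first exact: filterI.
by move=> a b [Na _] [_ N'b]; apply: NU.
Qed.

(** If P is a neighborhood of 1 and P Y is contained in U, then so is the
closure of Y: each y in the closure has some z in Y with y z^-1 in P. *)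
Lemma topgroup_regular x U : nbhs x U ->
  exists E, [/\ nbhs x E, closed E & E `<=` U].
Proof.
rewrite -{1}(mul1g x) => /nbhs_mulP[P [Y [P1 Yx PYU]]].
exists (closure Y); split; first exact: filterS (@subset_closure _ _) Yx.
  exact: closed_closure.
move=> y clY.
have /clY [z [Yz Pyz]] : nbhs y [set z | P (y * z^-1)].
  move: P1; rewrite -{1}(mulgV y) => /nbhs_mulP[Q [Q' [/nbhs_singleton Qy]]].
  by move=> /nbhs_invP Q'y QP; apply: filterS Q'y => z; apply: QP.
by rewrite -(mulgVK z y); apply: PYU.
Qed.

Lemma expg_continuous (n : nat) : continuous (fun x : G => x ^+ n).
Proof.
elim: n => [|n IH] x; first exact: cvg_cst.
rewrite (_ : (fun x : G => _) = fun x => x * x ^+ n); last first.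
  by apply/funext => y; rewrite expgS.
apply: (@continuous2_cvg _ _ _ _ _ _ _ _ (fun a b : G => a * b)).
- exact: (@mulg_continuous G (_, _)).
- exact: cvg_id.
- exact: IH.
Qed.

(** The integer power of x with exponent p.1 - p.2.  Pairs of naturals keep
the proof that all powers form a subgroup free of case distinctions. *)
Definition zpow x (p : nat * nat) := x ^+ p.1 * (x ^+ p.2)^-1.

Lemma zpow_continuous p : continuous (zpow^~ p).
Proof.
move=> x; apply: (@continuous2_cvg _ _ _ _ _ _ _ _ (fun a b : G => a * b)).
- exact: (@mulg_continuous G (_, _)).
- exact: expg_continuous.
- by apply: continuous_cvg; [exact: invg_continuous|exact: expg_continuous].
Qed.

Lemma zpow_subgroup x : subgroup (range (zpow x)).
Proof.
split; first by apply/mem_set; exists (0, 0)%N; rewrite // /zpow mulgV.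
move=> _ _ /set_mem[[i j] _ <-] /set_mem[[k l] _ <-]; apply/mem_set.
exists (i + l, k + j)%N => //; rewrite /zpow /= !invgM !invgK !expgnDr invgM.
rewrite -!mulgA; congr (_ * _); rewrite !mulgA; congr (_ * _).
exact/commute_sym/commute_sym/commuteV/commuteX2.
Qed.

(** For each x in V, either x = 1, or some power of x leaves V and, V being
closed, so does the same power of every nearby point.  Compactness of V then
bounds the exponents that are needed. *)
Lemma nss_escape (V : set G) : compact V ->
  (forall H, subgroup H -> H `<=` V -> H = [set 1]) ->
  forall N, nbhs 1 N -> exists n, forall x,
    (forall i j : 'I_n.+2, V (zpow x (i : nat, j : nat))) -> N x.
Proof.
move=> cptV nssV N N1.
pose P (n : nat) x :=
  (forall i j : 'I_n.+2, V (zpow x (i : nat, j : nat))) -> N x.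
have clV : closed V by apply: compact_closed => //; exact: topgroup_hausdorff.
have [|n _ /(_ n (leqnn _)) VP] := (compact_near_coveringP V).1 cptV _ \oo P _.
  move=> x _; have [Hx|] := pselect (range (zpow x) `<=` V).
    have -> : x = 1.
      have : range (zpow x) x.
        by exists (1, 0)%N; rewrite // /zpow expg1 invg1 mulg1.
      by rewrite (nssV _ (zpow_subgroup x) Hx).
    exists (N, setT) => /=; first by split => //; exact: filterT.
    by move=> [y n] [Ny _] _.
  move=> /existsNP[_ /not_implyP[[p _ <-] nVp]].
  exists ([set y | ~ V (zpow y p)], [set n | (p.1 + p.2 <= n)%N]) => /=.
    split; last exact: nbhs_infty_ge.
    apply: (@zpow_continuous p x (~` V)); apply: open_nbhs_nbhs; split => //.
    exact: closed_openC.
  move=> [y n] /= [nVy pn] Vy; exfalso; apply: nVy.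
  have h1 : (p.1 < n.+2)%N by rewrite ltnS leqW// (leq_trans _ pn)// leq_addr.
  have h2 : (p.2 < n.+2)%N by rewrite ltnS leqW// (leq_trans _ pn)// leq_addl.
  exact: (Vy (Ordinal h1) (Ordinal h2)).
exists n => x Vx; apply: VP => //.
(* The bound n.+2 makes the exponent pair (1, 0), which gives x itself,
   available even for n = 0. *)
have := Vx (@Ordinal n.+2 1 isT) ord0.
by rewrite /zpow expg1 invg1 mulg1.
Qed.
End topological_group.

(** * Ultrafilters, compactness and morphisms *)

Lemma ultra_fmap_cvg (I : Type) (T : topologicalType) (F : set_system I)
  (f : I -> T) (P : set T) : UltraFilter F -> compact P -> F (f @^-1` P) ->
  exists2 p, P p & f @ F --> p.
Proof.
move=> FU cptP FP.
have [p [Pp clp]] := cptP (f @ F) _ FP.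
exists p => // U Up.
have [//|FnU] := in_ultra_setVsetC (f @^-1` U) FU.
by have [y []] := clp (~` U) U FnU Up.
Qed.

Lemma morph1 (G H : groupType) (f : G -> H) : {morph f : x y / x * y} ->
  f 1 = 1.
Proof. by move=> fM; apply: (@mulgI _ (f 1)); rewrite -fM !mulg1. Qed.

Lemma morphVg (G H : groupType) (f : G -> H) : {morph f : x y / x * y} ->
  {morph f : x / x^-1}.
Proof.
by move=> fM x; apply: (@mulgI _ (f x)); rewrite -fM !mulgV morph1.
Qed.

Lemma morph_zpow (G H : topGroupType) (f : G -> H) : {morph f : x y / x * y} ->
  forall x p, f (zpow x p) = zpow (f x) p.
Proof.
move=> fM x p; have fX n : f (x ^+ n) = f x ^+ n.
  by elim: n => [|n IH]; rewrite ?expg0 ?morph1// !expgS fM IH.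
by rewrite /zpow fM morphVg// !fX.
Qed.

Lemma morph_range_subgroup (G H : groupType) (f : G -> H) :
  {morph f : x y / x * y} -> subgroup (range f).
Proof.
move=> fM; split; first by apply/mem_set; exists 1; rewrite ?morph1.
move=> _ _ /set_mem[x _ <-] /set_mem[y _ <-]; apply/mem_set.
by exists (x * y^-1); rewrite // fM morphVg.
Qed.

Lemma morph_continuous (G H : topGroupType) (f : G -> H) :
  {morph f : x y / x * y} -> (forall N, nbhs 1 N -> nbhs 1 (f @^-1` N)) ->
  continuous f.
Proof.
move=> fM f1 x U /nbhs_mulgl/f1/(nbhs_divgl x); apply: filterS => y /=.
by rewrite -fM mulVKg.
Qed.

(** If finitely many powers of g lie in C, their images lie in V, and
[nss_escape] locates f g; the exponents depend only on V and N, so the same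
neighborhood of 1 serves all f.  Applied to a pointwise limit of continuous
homomorphisms, this yields the continuity of the limit. *)
Lemma nss_equicontinuous (G A : topGroupType) (C : set G) (V : set A) :
  nbhs 1 C -> compact V ->
  (forall H, subgroup H -> H `<=` V -> H = [set 1]) ->
  forall N, nbhs 1 N -> \forall g \near (1 : G),
    forall f : G -> A, {morph f : x y / x * y} -> f @` C `<=` V -> N (f g).
Proof.
move=> C1 cptV nssV N /(nss_escape cptV nssV)[n DN].
have : \forall g \near (1 : G), forall p : 'I_n.+2 * 'I_n.+2,
    C (zpow g (p.1 : nat, p.2 : nat)).
  apply: filter_forall => p.
  apply: (@zpow_continuous G (p.1 : nat, p.2 : nat) 1 C).
  by rewrite (_ : zpow 1 _ = 1)// /zpow !expg1n mulgV.
apply: filterS => g Cg f fM fCV; apply: DN => i j.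
apply: fCV; exists (zpow g (i : nat, j : nat)); first exact: (Cg (i, j)).
exact: morph_zpow.
Qed.

(** At a continuous limit, convergence in the compact-open topology is uniform
convergence on compact sets.  From left to right, C is covered by pieces
C `&` E on which f varies little, with E closed so that the pieces are compact;
such E exist because G is regular. *)
Lemma compact_open_cvg_groupP (G A : topGroupType) (f : G -> A)
    (F : set_system {compact-open, G -> A}) : Filter F -> continuous f ->
  F --> (f : {compact-open, G -> A}) <->
  forall C N, compact C -> nbhs 1 N ->
    \forall d \near F, forall x : G, C x -> N ((f x)^-1 * d x).
Proof.
move=> FF cf; split=> [/compact_open_cvgP Ff C N cptC|FfN].
  move=> /nbhs1_divP[N' N'1 N'N].
  have := (near_covering_withinP C).2 ((compact_near_coveringP C).1 cptC).
  apply => x Cx.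
  pose O := [set a | N' ((f x)^-1 * a)]°.
  have ON' a : O a -> N' ((f x)^-1 * a).
    exact: (@interior_subset _ [set a | _]).
  have /cf/topgroup_regular[E [Ex clE EO]] : nbhs (f x) O.
    by apply/nbhs_interior/nbhs_divgl.
  have fO : f @` (C `&` E) `<=` O by move=> _ [y [_ Ey] <-]; exact: EO.
  have FdO := Ff _ _ (compact_closedI cptC clE) (open_interior _) fO.
  exists (E, [set d | d @` (C `&` E) `<=` O]) => //= -[y d] [/= Ey dO] Cy.
  have dy : N' ((f x)^-1 * d y) by apply/ON'/dO; exists y.
  have fy : N' ((f x)^-1 * f y) by exact/ON'/EO.
  by have := N'N _ _ fy dy; rewrite invgM invgK -mulgA mulVKg.
apply/compact_open_cvgP => C O cptC oO fCO.
have ON : \forall b \near (1 : A), C `<=` (fun x => O (f x * b)).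
  apply: (compact_near_coveringP C).1 => // x Cx.
  have : nbhs (f x * 1) O.
    by rewrite mulg1; apply: open_nbhs_nbhs; split => //; apply: fCO; exists x.
  move=> /nbhs_mulP[N [N' [/cf Nx N'1 NO]]].
  by exists (f @^-1` N, N') => // -[y b] [/= ? ?]; exact: NO.
apply: filterS (FfN _ _ cptC ON) => d dN _ [x Cx <-].
by have := dN x Cx x Cx; rewrite mulVKg.
Qed.

(** A compact neighborhood of the identity is moved to any x by the
left translation by x. *)
Lemma compact_nbhs1_locally_compact (T : topologicalType) (mul : T -> T -> T)
    (one : T) (inv : T -> T) (W : set T) :
  [/\ associative mul, left_id one mul & left_inverse one inv mul] ->
  continuous (fun x : T * T => mul x.1 x.2) -> hausdorff_space T ->
  nbhs one W -> compact W -> locally_compact [set: T].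
Proof.
move=> [mulA mul1 mulV] cmul hT W1 cptW x _.
have cmulx y : continuous (mul y).
  move=> z; apply: (@continuous2_cvg _ _ _ _ _ _ _ _ (fun a b => mul a b)).
  - exact: cmul (_, _).
  - exact: cvg_cst.
  - exact: cvg_id.
have cptxW : compact (mul x @` W).
  by apply: continuous_compact => //; exact: continuous_subspaceT.
exists (mul x @` W); last first.
  by split => //; exact: compact_closed.
have : nbhs x (mul (inv x) @^-1` W) by apply: cmulx; rewrite mulV.
have mulrV : mul x (inv x) = one.
  rewrite -(mul1 (mul x _)) -{1}(mulV (inv x)) -mulA (mulA (inv x)) mulV mul1.
  exact: mulV.
apply: filterS => y /= Wy _; exists (mul (inv x) y) => //.
by rewrite mulA mulrV mul1.
Qed.

(** On an infinite set the cofinite filter is proper, and it has no cluster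
point when the points are isolated. *)
Lemma compact_discrete_finite (T : topologicalType) :
  (forall x : T, nbhs x [set x]) -> compact [set: T] -> finite_set [set: T].
Proof.
move=> dT cptT; apply: contrapT => infT.
pose F : set_system T := [set S | finite_set (~` S)].
have FF : ProperFilter F.
  split; first by rewrite /F /= setC0.
  split; rewrite /F /=.
  - by rewrite setCT; exact: finite_set0.
  - move=> P Q fP fQ; apply: (@sub_finite_set _ _ (~` P `|` ~` Q)).
      by move=> x /not_andP.
    by rewrite finite_setU.
  - by move=> P Q PQ; apply: sub_finite_set; exact: subsetC.
have [p [_ clp]] := cptT F FF filterT.
have Fp : F (~` [set p]) by rewrite /F /= setCK; exact: finite_set1.
by have [q []] := clp _ _ Fp (dT p).
Qed.

(** * The first cohomology as a group of homomorphisms *)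

Section trivial_action.
Context (G A : topGroupType) (M : pcModule G A).
Hypothesis abG : forall g h : G, g * h = h * g.
Hypothesis trivA : trivial_module M.
Implicit Types c d : H1 M.

(** The commutator subgroup always contains 1, so the Peiffer condition applies
to the kernel of mu. *)
Lemma ker_mu_central a b : pc_mu M a = 1 -> a * b = b * a.
Proof.
move=> mua; have := @pc_peiffer _ _ M a b; rewrite trivA => /(_ _)/wrap[].
  by rewrite mua => S [[S1 _] _]; exact/set_mem.
by move=> {2}->; rewrite mulgVK.
Qed.

Definition ker_hom (f : G -> A) :=
  [/\ continuous f, {morph f : x y / x * y} & forall g, pc_mu M (f g) = 1].

Lemma der_map_ker_hom (x : Der M) : ker_hom (der_map x).
Proof.
case: (der_mapP x) => cx hx mx; split => // [g h|g].
  by rewrite hx trivA.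
by rewrite mx (abG g) mulgK mulgV.
Qed.

Lemma ker_hom_Der_set (f : G -> A) (r : G) : ker_hom f -> Der_set M (f, r).
Proof.
move=> [cf fM fmu]; split => //= [g h|g]; first by rewrite trivA fM.
by rewrite fmu (abG g) mulgK mulgV.
Qed.

Definition Der_of (f : G -> A) (r : G) (Hf : ker_hom f) : Der M :=
  exist _ (f, r) (mem_set (ker_hom_Der_set r Hf)).

(** Conjugation fixes the central values of a derivation, and H^0(G, G) = G
absorbs any change of the second component. *)
Lemma der_equivP (x y : Der M) : der_equiv x y <-> der_map x = der_map y.
Proof.
split=> [[a [yE _]]|xy].
  apply/funext => g; have [_ _ mx] := der_map_ker_hom x.
  by rewrite yE trivA -mulgA (ker_mu_central _ (mx g)) mulKg.
exists 1; split=> [g|]; first by rewrite trivA invg1 mul1g mulg1 xy.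
exists ((der_elt x)^-1 * der_elt y).
  by apply/H0_conjP => g; exact: abG.
by rewrite pc_mu1 invg1 mul1g mulVKg.
Qed.

Definition H1_hom c : G -> A := der_map (repr c).

Lemma H1_hom_class x : H1_hom (H1_class x) = der_map x.
Proof. by apply/der_equivP/H1_classP; exact: reprK. Qed.

Lemma H1_homP c : ker_hom (H1_hom c).
Proof. exact: der_map_ker_hom. Qed.

Lemma H1_hom_inj : injective H1_hom.
Proof.
move=> c d; have [[x <-] [y <-]] := (H1_class_surj c, H1_class_surj d).
by rewrite !H1_hom_class => xy; apply/H1_classP/der_equivP.
Qed.

Definition H1_of f (Hf : ker_hom f) : H1 M := H1_class (Der_of 1 Hf).

Lemma H1_ofK f (Hf : ker_hom f) : H1_hom (H1_of Hf) = f.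
Proof. by rewrite H1_hom_class. Qed.

Lemma H1_hom_continuous : continuous (H1_hom : H1 M -> {compact-open, G -> A}).
Proof.
apply/quotient_continuous.
have -> : H1_hom \o \pi_(quotient_topology {eq_quot der_equivb M}) =
    @der_map _ _ M.
  by apply/funext => x; exact: H1_hom_class.
move=> x; apply: (@continuous_comp _ _ _ (fun x : Der M => set_val x) fst).
  exact: initial_continuous.
exact: cvg_fst.
Qed.

(** The topology of H^1 is induced by [H1_hom]: a quotient-open set containing
c pulls back to a neighborhood of (H1_hom c, r), r being the second component
of the representative of c, and each d with H1_hom d near H1_hom c is also
represented by (H1_hom d, r) with the same r. *)
Lemma H1_hom_cvgP (F : set_system (H1 M)) c : Filter F ->
  F --> c <-> H1_hom @ F --> (H1_hom c : {compact-open, G -> A}).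
Proof.
move=> FF; split=> [Fc|Fc].
  exact: continuous_cvg (@H1_hom_continuous c) Fc.
move=> U; rewrite nbhsE => -[O [oO Oc] OU]; apply: filterS OU _.
have [Q oQ QO] : open (H1_class (M := M) @^-1` O).
  by have /continuousP := @pi_continuous _ {eq_quot der_equivb M}; apply.
set r := der_elt (repr c).
have : nbhs (H1_hom c : {compact-open, G -> A}, r) Q.
  apply: open_nbhs_nbhs; split => //.
  have : (H1_class (M := M) @^-1` O) (repr c).
    by rewrite /= /H1_class reprK.
  by rewrite -QO /= /H1_hom /r /der_map /der_elt; case: (set_val _).
move=> [[P R] /= [Pc /nbhs_singleton Rr] PRQ].
have FP : F (H1_hom @^-1` P) := Fc _ Pc.
apply: filterS FP => d Pd.
have : (set_val @^-1` Q) (Der_of r (H1_homP d)) by exact: (PRQ (_, _)).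
rewrite QO /=; congr O; apply: H1_hom_inj; exact: H1_hom_class.
Qed.

Lemma H1_cvgP (F : set_system (H1 M)) c : Filter F ->
  F --> c <-> forall C N, compact C -> nbhs 1 N ->
    \forall d \near F, forall x : G, C x -> N ((H1_hom c x)^-1 * H1_hom d x).
Proof.
move=> FF; rewrite H1_hom_cvgP.
by have [cc _ _] := H1_homP c; exact: (compact_open_cvg_groupP _ cc).
Qed.

Lemma H1_near c (C : set G) N : compact C -> nbhs 1 N ->
  \forall d \near c, forall x, C x -> N ((H1_hom c x)^-1 * H1_hom d x).
Proof. by move=> ? ?; apply: (H1_cvgP c (nbhs_filter c)).1 => // U. Qed.

Lemma ker_hom1 : ker_hom (fun=> 1).
Proof.
split => [x|x y|g]; first exact: cvg_cst.
  by rewrite mulg1.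
by rewrite pc_mu1.
Qed.

Lemma ker_homM f g : ker_hom f -> ker_hom g -> ker_hom (fun x => f x * g x).
Proof.
move=> [cf fM fmu] [cg gM gmu]; split=> [x|x y|x].
- apply: (@continuous2_cvg _ _ _ _ _ _ _ _ (fun a b : A => a * b)).
  + exact: (@mulg_continuous A (_, _)).
  + exact: cf.
  + exact: cg.
- by rewrite fM gM -!mulgA (mulgA (f y)) -(ker_mu_central _ (gmu x)) !mulgA.
- by rewrite pc_muM fmu gmu mulg1.
Qed.

Lemma ker_homV f : ker_hom f -> ker_hom (fun x => (f x)^-1).
Proof.
move=> [cf fM fmu]; split=> [x|x y|x].
- by apply: continuous_cvg; [exact: invg_continuous|exact: cf].
- by rewrite fM (ker_mu_central _ (fmu x)) invgM.
- by rewrite pc_muV fmu invg1.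
Qed.

Definition H1_mul c d : H1 M := H1_of (ker_homM (H1_homP c) (H1_homP d)).
Definition H1_one : H1 M := H1_of ker_hom1.
Definition H1_inv c : H1 M := H1_of (ker_homV (H1_homP c)).

Lemma H1_mulC : commutative H1_mul.
Proof.
move=> c d; apply: H1_hom_inj; rewrite !H1_ofK; apply/funext => x.
by have [_ _ mc] := H1_homP c; exact: ker_mu_central.
Qed.

Lemma H1_mul_class x y : H1_mul (H1_class x) (H1_class y) = H1_class (star x y).
Proof.
apply: H1_hom_inj; rewrite H1_ofK !H1_hom_class; apply/funext => g.
have [_ _ mx] := der_map_ker_hom x.
by rewrite (ker_mu_central _ (mx g)) -[in LHS](trivA (der_elt x) (der_map y g)).
Qed.

Lemma H1_group_axioms :
  [/\ associative H1_mul, left_id H1_one H1_mul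
    & left_inverse H1_one H1_inv H1_mul].
Proof.
split=> [b c d|c|c]; apply: H1_hom_inj; rewrite !H1_ofK; apply/funext => x.
- by rewrite mulgA.
- by rewrite mul1g.
- by rewrite mulVg.
Qed.

Lemma H1_mul_continuous : continuous (fun x : H1 M * H1 M => H1_mul x.1 x.2).
Proof.
move=> [c d]; apply/H1_cvgP => C N cptC.
rewrite -{1}(mulg1 1) => /nbhs_mulP[N1 [N2 [N11 N21 N12]]].
have nc := @H1_near c _ _ cptC N11.
have nd := @H1_near d _ _ cptC N21.
exists ([set c' | forall x, C x -> N1 ((H1_hom c x)^-1 * H1_hom c' x)],
  [set d' | forall x, C x -> N2 ((H1_hom d x)^-1 * H1_hom d' x)]) => //.
move=> [c' d'] /= [Hc Hd] x Cx; rewrite !H1_ofK.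
have [[_ _ mc] [_ _ mc']] := (H1_homP c, H1_homP c').
have mu1 : pc_mu M ((H1_hom c x)^-1 * H1_hom c' x) = 1.
  by rewrite pc_muM pc_muV mc mc' mulVg.
suff -> : (H1_hom c x * H1_hom d x)^-1 * (H1_hom c' x * H1_hom d' x) =
    ((H1_hom c x)^-1 * H1_hom c' x) * ((H1_hom d x)^-1 * H1_hom d' x).
  exact: N12 (Hc x Cx) (Hd x Cx).
by rewrite [RHS]mulgA (ker_mu_central _ mu1) invgM !mulgA.
Qed.

Lemma H1_inv_continuous : continuous H1_inv.
Proof.
move=> c; apply: (H1_cvgP _ (fmap_filter _ (nbhs_filter c))).2 => C N cptC.
rewrite -{1}(@invg1 A) => /nbhs_invP N1.
apply: filterS (@H1_near c _ _ cptC N1) => c' Nc x Cx.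
have := Nc x Cx; rewrite !H1_ofK /=.
have [_ _ mc] := H1_homP c.
by rewrite invgM invgK (ker_mu_central _ (mc x)).
Qed.

Lemma H1_eval_continuous (g : G) : continuous (fun c => H1_hom c g).
Proof.
move=> c U /nbhs_mulgl Uc.
apply: filterS (@H1_near c _ _ (@compact_set1 _ g) Uc) => d /(_ g erefl).
by rewrite /= mulVKg.
Qed.

Lemma H1_hausdorff : hausdorff_space (H1 M).
Proof.
move=> c d clcd; apply: H1_hom_inj; apply/funext => g.
apply: (@topgroup_hausdorff A) => P Q.
move=> /H1_eval_continuous Pc /H1_eval_continuous Qd.
by have [e [Pe Qe]] := clcd _ _ Pc Qd; exists (H1_hom e g).
Qed.

Lemma H1_is_topological_abelian_group : H1_topological_abelian_group M.
Proof.
exists H1_mul; split; [exact: H1_mul_class| |exact: H1_mulC].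
exists H1_one, H1_inv; split; first exact: H1_group_axioms.
split; [exact: H1_mul_continuous|exact: H1_inv_continuous|exact: H1_hausdorff].
Qed.

(** * Compactness of sets of homomorphisms *)

(** A form of the Ascoli theorem.  The pointwise limit of an ultrafilter is a
homomorphism with values in the kernel of mu that maps C into V, hence is
continuous by equicontinuity.  Near x in a compact set K, writing y = x t, the
difference of f and d at y is f(t)^-1 (f(x)^-1 d(x)) d(t), where the outer
factors are small by equicontinuity and the middle one by convergence at x;
finitely many x suffice. *)
Lemma H1_bounded_compact (C : set G) (V : set A) :
  nbhs 1 C -> compact V ->
  (forall H, subgroup H -> H `<=` V -> H = [set 1]) ->
  (forall g, exists2 P, compact P &
    forall c, H1_hom c @` C `<=` V -> P (H1_hom c g)) ->
  compact [set c | H1_hom c @` C `<=` V].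
Proof.
move=> C1 cptV nssV bdd; rewrite compact_ultra => F FU FW.
have FF : ProperFilter F by exact: ultra_proper.
have /choice[f fP] : forall g, exists a : A, (fun c => H1_hom c g) @ F --> a.
  move=> g; have [P cptP WP] := bdd g.
  by have [|a _ ?] := ultra_fmap_cvg FU cptP (f := fun c => H1_hom c g);
    [exact: filterS FW|exists a].
have fM : {morph f : x y / x * y}.
  move=> x y; apply: (cvg_unique (@topgroup_hausdorff A) (fP (x * y))).
  have -> : (fun c => H1_hom c (x * y)) = fun c => H1_hom c x * H1_hom c y.
    by apply/funext => c; have [_ -> _] := H1_homP c.
  apply: (@continuous2_cvg _ _ _ _ _ _ _ _ (fun a b : A => a * b)) => //.
  exact: (@mulg_continuous A (_, _)).
have fmu g : pc_mu M (f g) = 1.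
  have cf : (fun c => pc_mu M (H1_hom c g)) @ F --> pc_mu M (f g).
    by apply: continuous_cvg => //; exact: pc_mu_continuous.
  apply: (cvg_unique (@topgroup_hausdorff G) cf).
  have -> : (fun c => pc_mu M (H1_hom c g)) = fun=> 1.
    by apply/funext => c; have [_ _] := H1_homP c.
  exact: cvg_cst.
have fCV : f @` C `<=` V.
  have clV : closed V.
    by apply: compact_closed => //; exact: topgroup_hausdorff.
  move=> _ [x Cx <-]; apply: (@closed_cvg _ _ _ _ _ V clV _ _ (fP x)).
  by apply: filterS FW => c; apply; exists x.
have equi := nss_equicontinuous C1 cptV nssV.
have cf : continuous f.
  apply: morph_continuous => // N /equi; apply: filterS => g; exact.
exists (H1_of (And3 cf fM fmu)); split; first by rewrite /= H1_ofK.
apply/H1_cvgP => K N cptK; rewrite H1_ofK.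
move=> /nbhs1_divP[N1 N11 N1N].
move: (N11); rewrite -{1}(mulg1 1) => /nbhs_mulP[N2 [N3 [N21 N31 N23]]].
apply: (compact_near_coveringP K).1 => // x Kx.
have Fx : F [set d | N2 ((f x)^-1 * H1_hom d x)].
  by apply: (fP x [set a | N2 ((f x)^-1 * a)]); exact: nbhs_divgl.
exists ([set y | forall h : G -> A, {morph h : x y / x * y} -> h @` C `<=` V ->
    (N1 `&` N3) (h (x^-1 * y))],
  [set c | H1_hom c @` C `<=` V] `&`
    [set d | N2 ((f x)^-1 * H1_hom d x)]) => /=.
  split; last exact: filterI.
  exact: (@nbhs_divgl _ x _ (equi _ (filterI N11 N31))).
move=> [y d] /= [Hy [dV Nd]]; have [_ dM _] := H1_homP d.
have [Nf _] := Hy _ fM fCV; have [_ Nd'] := Hy _ dM dV.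
have := N1N _ _ Nf (N23 _ _ Nd Nd').
by rewrite !fM !dM !morphVg// invgM invgK !mulgA !mulgK.
Qed.
End trivial_action.

(** * Local compactness, finiteness and discreteness *)

Lemma nss_compact_nbhs (A : topGroupType) :
  locally_compact [set: A] -> no_small_subgroups A ->
  exists V : set A, [/\ nbhs 1 V, compact V &
    forall H, subgroup H -> H `<=` V -> H = [set 1]].
Proof.
move=> lcA [U U1 nssU]; have [B + [cptB _]] := lcA 1 I; rewrite withinET => B1.
have [E [E1 clE EU]] := topgroup_regular U1.
exists (B `&` E); split; first exact: filterI.
  exact: compact_closedI.
by move=> H sH HBE; apply: nssU => // x /HBE[_ /EU].
Qed.

Lemma compact_locally_compact (T : topologicalType) :
  compact [set: T] -> locally_compact [set: T].
Proof.
move=> cptT x _; exists setT; first exact: filterT.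
by split => //; exact: closedT.
Qed.

Section conclusions.
Context (G A : topGroupType) (M : pcModule G A).
Hypothesis abG : forall g h : G, g * h = h * g.
Hypothesis trivA : trivial_module M.
Implicit Types c d : H1 M.

Lemma H1_locally_compact (C : set G) (V : set A) :
  compact C -> nbhs 1 C -> nbhs 1 V -> compact V ->
  (forall H, subgroup H -> H `<=` V -> H = [set 1]) ->
  (forall g, exists2 P, compact P &
     forall c, H1_hom c @` C `<=` V -> P (H1_hom c g)) ->
  locally_compact [set: H1 M].
Proof.
move=> cptC C1 V1 cptV nssV bdd.
have W1 : nbhs (H1_one abG trivA) [set c | H1_hom c @` C `<=` V].
  apply: filterS (H1_near abG trivA (H1_one abG trivA) cptC V1).
  by move=> c cV _ [x Cx <-]; have := cV x Cx; rewrite H1_ofK invg1 mul1g.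
apply: (compact_nbhs1_locally_compact (H1_group_axioms abG trivA) _
  (H1_hausdorff abG trivA) W1).
  exact: (@H1_mul_continuous _ _ _ abG trivA).
exact: (H1_bounded_compact abG trivA C1 cptV nssV bdd).
Qed.

(** The points g at which the values are bounded form a subgroup: a bound at
g h^-1 is the compact set P Q^-1 for bounds P at g and Q at h.  It contains K,
where V is a bound. *)
Lemma generated_bounded (K C : set G) (V : set A) :
  compact V -> K `<=` C -> generated K = [set: G] ->
  forall g, exists2 P, compact P &
    forall c, H1_hom c @` C `<=` V -> P (H1_hom c g).
Proof.
move=> cptV KC genK.
pose bdd := [set g : G | exists2 P, compact P &
    forall c, H1_hom c @` C `<=` V -> P (H1_hom c g)].
suff bddT : [set: G] `<=` bdd by move=> g; exact: bddT.
rewrite -genK; apply: smallest_sub; last first.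
  by move=> g /KC Cg; exists V => // c; apply; exists g.
split; first apply/mem_set.
  exists [set 1]; first exact: compact_set1.
  by move=> c _; have [_ cM _] := H1_homP abG trivA c; rewrite /= morph1.
move=> g h /set_mem[P cptP Pg] /set_mem[Q cptQ Qh]; apply/mem_set.
exists ((fun p => p.1 * p.2^-1) @` (P `*` Q)).
  apply: continuous_compact; last exact: compact_setX.
  by apply: continuous_subspaceT; exact: divg_continuous.
move=> c cV; have [_ cM _] := H1_homP abG trivA c.
exists (H1_hom c g, H1_hom c h); first by split; [exact: Pg|exact: Qh].
by rewrite /= cM morphVg.
Qed.

(** If d is close to c on all of G, the pointwise quotient of d by c is a
homomorphism whose image is a small subgroup, hence trivial. *)
Lemma H1_discrete : compact [set: G] -> no_small_subgroups A ->
  forall c, nbhs c [set c].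
Proof.
move=> cptG [U U1 nssU] c.
apply: filterS (H1_near abG trivA c cptG U1) => d dU.
have := H1_homP abG trivA (H1_mul abG trivA (H1_inv abG trivA c) d).
rewrite !H1_ofK => -[_ /morph_range_subgroup sf _].
have f1 : range (fun x => (H1_hom c x)^-1 * H1_hom d x) = [set 1].
  by apply: nssU => // _ [x _ <-]; exact: dU.
apply: (H1_hom_inj abG trivA); apply/funext => x.
apply: (@mulgI _ (H1_hom c x)^-1); rewrite mulVg.
suff : [set 1] ((H1_hom c x)^-1 * H1_hom d x) by [].
by rewrite -f1; exists x.
Qed.

End conclusions.

Theorem theorem3p7 (G A : topGroupType) (M : pcModule G A)
    (lcG : locally_compact [set: G])
    (abG : forall g h : G, g * h = h * g)
    (trivA : trivial_module M) :
  [/\ compact [set: A] -> no_small_subgroups A ->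
        H1_topological_abelian_group M /\ locally_compact [set: H1 M],
      compactly_generated G ->
      locally_compact [set: A] -> no_small_subgroups A ->
        H1_topological_abelian_group M /\ locally_compact [set: H1 M]
    & finite_set [set: G] -> discrete_space G ->
      compact [set: A] -> no_small_subgroups A ->
        [/\ H1_topological_abelian_group M, finite_set [set: H1 M]
          & discrete_space (H1 M)] ].
Proof.
have grp := H1_is_topological_abelian_group abG trivA.
have [C + [cptC _]] := lcG 1 I; rewrite withinET => C1.
split.
- move=> cptA nssA; split => //.
  have lcA := compact_locally_compact cptA.
  have [V [V1 cptV nssV]] := nss_compact_nbhs lcA nssA.
  by apply: (H1_locally_compact abG trivA cptC C1 V1) => // g; exists setT.
- move=> [K cptK genK] lcA nssA; split => //.
  have [V [V1 cptV nssV]] := nss_compact_nbhs lcA nssA.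
  apply: (H1_locally_compact abG trivA (compactU cptC cptK) _ V1 cptV nssV).
    by apply: filterS C1 => x; left.
  by apply: (generated_bounded abG trivA cptV _ genK) => x; right.
- move=> finG discG cptA nssA.
  have discH := H1_discrete abG trivA (finite_compact finG) nssA.
  split => //.
    have lcA := compact_locally_compact cptA.
    have [V [V1 cptV nssV]] := nss_compact_nbhs lcA nssA.
    (* As {1} is a neighborhood of 1, C = {1} is allowed, and every homomorphism
       maps C into V. *)
    have one1 : nbhs (1 : G) [set 1] by rewrite discG.
    have := H1_bounded_compact abG trivA one1 cptV nssV.
    move=> /(_ _)/wrap[]; [by move=> g; exists setT|move=> cptH].
    apply: compact_discrete_finite => //.
    suff -> : [set: H1 M] = [set c | H1_hom c @` [set 1] `<=` V] by [].
    apply/esym/seteqP; split => // c _ _ [_ -> <-].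
    have [_ cM _] := H1_homP abG trivA c.
    by rewrite morph1//; exact: nbhs_singleton.
  apply/funext => c; apply/funext => U; apply/propext; split=> [|Uc].
    by move=> /nbhs_singleton Uc; move=> _ ->.
  by apply: filterS (discH c) => _ ->; exact: Uc.
Qed.
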